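(* Let $p>3$ be a prime. Then $$\sum_{k=0}^{p-1}\binom{-\frac13}k^29^k\equiv\frac1{3^{[\frac p3]}}\sum_{k=0}^{p-1}\binom{-\frac13}k^2\frac1{9^k}\equiv\begin{cases}L\pmod p&\text{if }p\equiv1\pmod3,\text{ where }4p=L^2+27M^2,\ L,M\in\mathbb Z,\ 3\mid L-2,\\0\pmod p&\text{if }p\equiv2\pmod3.\end{cases}$$
   Context: $[x]$ is the floor. For rational $a$, $\binom ak=a(a-1)\cdots(a-k+1)/k!$. Congruences mod $p$ are among rationals with denominator coprime to $p$. *)

(* Defs.v *)
From mathcomp Require Import all_boot all_order all_algebra.

Set Implicit Arguments.
Unset Strict Implicit.
Unset Printing Implicit Defensive.

Import Order.TTheory GRing.Theory Num.Theory.
Local Open Scope ring_scope.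

Definition rbinom (a : rat) (k : nat) : rat :=
  (\prod_(i < k) (a - i%:R)) / k`!%:R.

Definition mod_integral (m : nat) (x : rat) : bool := coprime m `|denq x|%N.

(* [x = y (mod m)] is only meaningful for rationals whose denominators are
   coprime to [m], so that requirement is part of the relation. *)
Definition rat_congr (m : nat) (x y : rat) : Prop :=
  [/\ mod_integral m x, mod_integral m y & (m%:Z %| numq (x - y))%Z].

(* Main.v *)
(** Write F = F_p, q = p - 1, and let n < p be a natural number with 3n + 1 = 0 in F, so that
    -1/3 = n mod p and both sums reduce to S(x) = sum_k C(n,k)^2 x^k at x = 9 and x = 1/9, where
    S(1/9) = 9^-n S(9).  Expanding S in powers of x - 1 gives
    S(9) = 8^n sum_k C(n,k) C(n+k,k) / 8^k, and C(n,k) C(n+k,k) = (-1)^k (3k)! / (27^k k!^3) in F;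
    hence S(9) / 8^n is the coefficient of (xyz)^q in (x^3 + y^3 + z^3 + 6xyz)^q, that is, minus
    the sum H of these q-th powers over F^3.  The cubic x^3 + y^3 + z^3 + 6xyz is a Fermat cubic
    in disguise: with w a primitive cube root of unity, three times it is a^3 + b^3 + c^3 for
    a = x + y + z, b = x + wy + w^2 z, c = x + w^2 y + wz.  If p = 2 mod 3, cubing is bijective
    and H = 0.  If p = 1 mod 3, then n = (p - 1)/3 and the same coefficient for the Fermat cubic is
    C(2n,n) mod p, which Jacobi sums identify with L (Gauss). *)

Require Import Defs.
From mathcomp Require Import all_boot all_order all_algebra all_field.
From mathcomp Require Import ring lra zify.

Set Implicit Arguments.
Unset Strict Implicit.
Unset Printing Implicit Defensive.

Import Order.TTheory GRing.Theory Num.Theory.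
Local Open Scope ring_scope.

(** * Power sums and the Hesse cubic *)

Lemma expf_card_pred (F : finFieldType) (x : F) : x != 0 -> x ^+ #|F|.-1 = 1.
Proof.
move=> x0; apply: (mulfI x0); rewrite -exprS prednK ?expf_card ?mulr1 //.
by apply/card_gt0P; exists x.
Qed.

(** If every nonzero element had [a]-th power 1, then [X^r - 1] with [r = a %% q], [0 < r < q],
    would have [q > r] roots. *)
Lemma exists_expf_neq1 (F : finFieldType) (a : nat) :
  ~~ (#|F|.-1 %| a)%N -> exists2 g : F, g != 0 & g ^+ a != 1.
Proof.
move=> ndvd; set q := #|F|.-1 in ndvd *.
have Fgt1 : (1 < #|F|)%N := card_finNzRing_gt1 F.
have q_gt0 : (0 < q)%N by rewrite /q; lia.
have r_gt0 : (0 < a %% q)%N by rewrite lt0n -/(dvdn q a).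
have [/existsP[g /andP[g0 g1]]|] := boolP [exists g : F, (g != 0) && (g ^+ a != 1)].
  by exists g.
rewrite negb_exists => /forallP H.
pose rs := enum [pred x : F | x != 0].
have /(max_unity_roots r_gt0) : all (a %% q).-unity_root rs.
  apply/allP => x; rewrite mem_enum inE => x0.
  have := H x; rewrite x0 /= negbK => /eqP xa.
  apply/unity_rootP; rewrite -xa [in RHS](divn_eq a q) exprD mulnC exprM.
  by rewrite /q expf_card_pred // expr1n mul1r.
rewrite enum_uniq => /(_ isT); rewrite -cardE.
have -> : #|[pred x : F | x != 0]| = q.
  by rewrite /q (cardD1 0 F) inE add1n /=; apply: eq_card => x; rewrite !inE andbT.
by rewrite leqNgt ltn_pmod.
Qed.

(** If some nonzero [g] has [g ^+ a != 1], the substitution [x -> g x] multiplies the sum by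
    [g ^+ a], so the sum is 0. Otherwise all nonzero terms are 1. The case [a = 0] stands apart
    because [0 ^+ 0 = 1]. *)
Lemma sum_expf (F : finFieldType) (a : nat) :
  \sum_(x : F) x ^+ a = if (0 < a)%N && (#|F|.-1 %| a)%N then - 1 else 0.
Proof.
have Fgt1 : (1 < #|F|)%N := card_finNzRing_gt1 F.
(* Translation by 1 permutes [F], so the sum of [x + 1] equals the sum of [x]. *)
have sum1 : \sum_(x : F) 1 = 0 :> F.
  have /(congr1 (fun y => y - \sum_(x : F) x)) :
      \sum_(x : F) (x + 1) = \sum_(x : F) x.
    by rewrite [RHS](reindex_inj (addIr 1)).
  by rewrite big_split /= subrr addrAC subrr add0r.
have [->|a_gt0] /= := posnP a; first by under eq_bigr do rewrite expr0.
case: ifPn => [/dvdnP[k a_eq]|/exists_expf_neq1[g g0 ga]].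
  rewrite (bigD1 0) //= expr0n eqn0Ngt a_gt0 add0r.
  rewrite (eq_bigr (fun=> 1)) => [|x x0].
    by move: sum1; rewrite (bigD1 0) //= addrC => /eqP; rewrite addr_eq0 => /eqP.
  by rewrite a_eq mulnC exprM expf_card_pred // expr1n.
apply/eqP; have := @mulf_eq0 F (g ^+ a - 1) (\sum_x x ^+ a).
rewrite subr_eq0 (negPf ga) /= => <-.
rewrite mulrBl mul1r [X in _ - X](reindex_inj (mulfI g0)) /= mulr_sumr.
by under [X in _ - X]eq_bigr do rewrite exprMn; rewrite subrr.
Qed.

(** A nonzero factor needs an exponent that is a positive multiple of [q]; three such exponents with
    total [3 * q] all equal [q]. *)
Lemma sum_expf3 (F : finFieldType) (a b c : nat) (q := #|F|.-1) :
  (a + b + c = 3 * q)%N ->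
  (\sum_(x : F) x ^+ a) * (\sum_(x : F) x ^+ b) * (\sum_(x : F) x ^+ c) =
  if [&& a == q, b == q & c == q] then -1 else 0.
Proof.
have q_gt0 : (0 < q)%N by rewrite /q ltn_predRL card_finNzRing_gt1.
rewrite !sum_expf -/q => abc.
have [/and3P[/eqP-> /eqP-> /eqP->]|ne] := boolP [&& a == q, b == q & c == q].
  by rewrite q_gt0 dvdnn /=; ring.
case: ifPn => [/andP[a0 /(dvdn_leq a0) aq]|]; last by rewrite !mul0r.
case: ifPn => [/andP[b0 /(dvdn_leq b0) bq]|]; last by rewrite mulr0 mul0r.
case: ifPn => [/andP[c0 /(dvdn_leq c0) cq]|]; last by rewrite mulr0.
by case/negP: ne; apply/and3P; split; apply/eqP; lia.
Qed.

Lemma big_nat_mul3 (R : nmodType) (f : nat -> R) (n : nat) :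
  \sum_(0 <= m < 3 * n | (3 %| m)%N) f m = \sum_(0 <= j < n) f (3 * j)%N.
Proof.
elim: n => [|n IHn]; first by rewrite muln0 !big_geq.
rewrite big_nat_recr //= -IHn ![in LHS]big_mkcond [in RHS]big_mkcond /=.
have -> : (3 * n.+1 = (3 * n).+3)%N by lia.
do 3 rewrite [in LHS]big_nat_recr //=.
have -> : (3 %| 3 * n)%N by exact: dvdn_mulr.
have -> : (3 %| (3 * n).+1)%N = false by lia.
have -> : (3 %| (3 * n).+2)%N = false by lia.
by rewrite !addr0.
Qed.

(** The Hesse pencil of cubics; [l = 0] gives the Fermat cubic. *)
Definition cubic_form (R : nzRingType) (l x y z : R) : R :=
  x ^+ 3 + y ^+ 3 + z ^+ 3 + l * x * y * z.

(** Nonzero values of the form contribute 1 each, so this is minus its number of zeros in F^3, read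
    in [F]. *)
Definition cubic_form_sum (F : finFieldType) (l : F) : F :=
  \sum_(x : F) \sum_(y : F) \sum_(z : F) cubic_form l x y z ^+ #|F|.-1.

Lemma big_nat_vanish (V : nmodType) (n m : nat) (f : nat -> V) : (n <= m)%N ->
  (forall k, (n <= k)%N -> f k = 0) -> \sum_(0 <= k < m) f k = \sum_(k < n) f k.
Proof.
move=> nm f0; rewrite (big_cat_nat (n := n)) //= big_mkord.
rewrite [X in _ + X]big_nat_cond [X in _ + X]big1 ?addr0 // => k.
by rewrite andbT => /andP[nk _]; exact: f0.
Qed.

Lemma exchange_big3 (V : nmodType) (I : Type) (T : finType) (r : seq I)
    (P : pred I) (G : I -> T -> T -> T -> V) :
  \sum_x \sum_y \sum_z \sum_(i <- r | P i) G i x y z =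
  \sum_(i <- r | P i) \sum_x \sum_y \sum_z G i x y z.
Proof.
rewrite [RHS]exchange_big; apply: eq_bigr => x _ /=.
rewrite [RHS]exchange_big; apply: eq_bigr => y _ /=.
by rewrite [RHS]exchange_big.
Qed.

(* Only the monomials x^a y^b z^c with a = b = c = q survive summation over F^3, so the
   sum is minus the coefficient of (xyz)^q in the q-th power of the cubic form. *)
Lemma cubic_form_sumE (F : finFieldType) (l : F) (q := #|F|.-1) :
  cubic_form_sum l =
  - \sum_(0 <= j < q.+1)
      ('C(q, 3 * j) * ('C(3 * j, 2 * j) * 'C(2 * j, j)))%:R * l ^+ (q - 3 * j).
Proof.
(* Multinomial coefficient: among [q] factors, [m] supply a cube, [i] of these supply [y^3] or
   [z^3], and [k] of those supply [z^3]. *)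
pose c m i k : F := ('C(q, m) * ('C(m, i) * 'C(i, k)))%:R * l ^+ (q - m).
(* The range of [m] is padded with zero terms up to [3 * q.+1], so that its multiples of 3 can be
   reindexed by [big_nat_mul3]. *)
have expand (x y z : F) : cubic_form l x y z ^+ q =
    \sum_(0 <= m < (3 * q.+1)%N) \sum_(i < m.+1) \sum_(k < i.+1)
      c m i k * (x ^+ (3 * (m - i) + (q - m)) * y ^+ (3 * (i - k) + (q - m)) *
       z ^+ (3 * k + (q - m))).
  rewrite (@big_nat_vanish _ q.+1) => [||m qm]; first last.
  - by apply: big1 => i _; apply: big1 => k _; rewrite /c bin_small // mul0n !mul0r.
  - by rewrite leq_pmull.
  rewrite /cubic_form addrC exprDn; apply: eq_bigr => m _.
  rewrite -addrA exprDn mulr_sumr -sumrMnl; apply: eq_bigr => i _.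
  rewrite exprDn mulr_sumr -mulrnAl -!mulr_sumr mulr_sumr mulrC.
  rewrite -sumrMnl big_distrl /=; apply: eq_bigr => k _.
  rewrite /c -!exprM !exprMn !exprD !natrM.
  rewrite -(mulr_natl _ 'C(i, k)) -(mulr_natl _ 'C(m, i)) -(mulr_natl _ 'C(q, m)).
  by ring.
rewrite /cubic_form_sum -/q.
under eq_bigr do under eq_bigr do under eq_bigr do rewrite expand.
pose e j := ('C(q, 3 * j) * ('C(3 * j, 2 * j) * 'C(2 * j, j)))%:R * l ^+ (q - 3 * j).
transitivity (\sum_(0 <= m < 3 * q.+1 | (3 %| m)%N) - e (m %/ 3)%N); last first.
  by rewrite big_nat_mul3 sumrN; under eq_bigr do rewrite mulKn //.
rewrite exchange_big3 [RHS]big_mkcond; apply: eq_big_nat => m _.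
rewrite exchange_big3; under eq_bigr do rewrite exchange_big3.
have sep i k (a b d : nat) :
    \sum_(x : F) \sum_(y : F) \sum_(z : F) c m i k * (x ^+ a * y ^+ b * z ^+ d) =
    c m i k * ((\sum_(x : F) x ^+ a) * (\sum_(x : F) x ^+ b) * (\sum_(x : F) x ^+ d)).
  rewrite !big_distrl mulr_sumr /=; apply: eq_bigr => x _.
  rewrite -mulrA big_distrl !mulr_sumr /=; apply: eq_bigr => y _.
  by rewrite !mulr_sumr; apply: eq_bigr => z _; rewrite !mulrA.
under eq_bigr do under eq_bigr do rewrite sep.
have [q_lt_m|m_le_q] := ltnP q m.
  rewrite big1 => [|i _]; last by apply: big1 => k _; rewrite /c bin_small ?mul0n ?mul0r.
  case: ifP => // /divnK m3; rewrite mulnC in m3.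
  by rewrite /e m3 bin_small ?mul0n ?mul0r ?oppr0.
(* The three exponents add up to [3 * q]; all equal [q] exactly when [x^3], [y^3], [z^3] are chosen
   equally often. *)
have only i k : (i <= m)%N -> (k <= i)%N ->
    c m i k * ((\sum_(x : F) x ^+ (3 * (m - i) + (q - m))) *
      (\sum_(x : F) x ^+ (3 * (i - k) + (q - m))) *
      (\sum_(x : F) x ^+ (3 * k + (q - m)))) =
    if (m == 3 * k)%N && (i == 2 * k)%N then - c m i k else 0.
  move=> im ki; rewrite sum_expf3 -/q; last by lia.
  have -> : [&& 3 * (m - i) + (q - m) == q, 3 * (i - k) + (q - m) == q &
     3 * k + (q - m) == q]%N = (m == 3 * k)%N && (i == 2 * k)%N by lia.
  by case: ifP; rewrite ?mulrN1 ?mulr0.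
case: ifPn => [/dvdnP[j m_eq]|m3]; last first.
  apply: big1 => i _; apply: big1 => k _.
  rewrite only ?leq_ord // ifN //; apply: contra m3 => /andP[/eqP m3k _].
  by apply/dvdnP; exists (k : nat); rewrite mulnC.
have lt_2jm : (2 * j < m.+1)%N by lia.
have lt_j2j : (j < (2 * j).+1)%N by lia.
rewrite (bigD1 (Ordinal lt_2jm)) //= (bigD1 (Ordinal lt_j2j)) //= only; try lia.
rewrite ifT; last by lia.
rewrite [X in _ + X + _]big1 ?addr0 => [|k /eqP/val_eqP /= kj]; last first.
  by rewrite only ?leq_ord // ifN //; lia.
rewrite big1 ?addr0 => [|i /eqP/val_eqP /= ij]; last first.
  by apply: big1 => k _; rewrite only ?leq_ord // ifN //; lia.
by rewrite /e /c m_eq mulnK // (mulnC j).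
Qed.

(* With u = x - z, v = y - z, three times the form is (x + y + z)^3 + G(u, v); for fixed
   u and v the sum over z runs over all elements of F as soon as cubing is injective. *)
Lemma cubic_form_sum6_inj (F : finFieldType) :
  3%:R != 0 :> F -> injective (fun x : F => x ^+ 3) -> cubic_form_sum (6%:R : F) = 0.
Proof.
move=> F3 cube_inj; set q := #|F|.-1.
pose G (u v : F) := 2%:R * u ^+ 3 - 3%:R * u ^+ 2 * v - 3%:R * u * v ^+ 2 + 2%:R * v ^+ 3.
have form (u v z : F) : cubic_form 6%:R (u + z) (v + z) z =
    ((u + v + 3%:R * z) ^+ 3 + G u v) * 3%:R^-1.
  by apply: (mulIf F3); rewrite mulfVK // /G /cubic_form; ring.
transitivity (\sum_(u : F) \sum_(v : F) \sum_(z : F) (z * 3%:R^-1) ^+ q).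
  transitivity (\sum_(z : F) \sum_(u : F) \sum_(v : F) cubic_form 6%:R (u + z) (v + z) z ^+ q).
    rewrite [LHS]/cubic_form_sum -/q.
    transitivity (\sum_(x : F) \sum_(z : F) \sum_(y : F) cubic_form 6%:R x y z ^+ q).
      by apply: eq_bigr => x _; rewrite exchange_big.
    rewrite exchange_big; apply: eq_bigr => z _ /=.
    rewrite (reindex_inj (addIr z)); apply: eq_bigr => u _ /=.
    by rewrite (reindex_inj (addIr z)).
  rewrite exchange_big; apply: eq_bigr => u _; rewrite exchange_big; apply: eq_bigr => v _ /=.
  pose h z := (u + v + 3%:R * z) ^+ 3 + G u v.
  have h_inj : injective h.
    by move=> z z' /addIr/cube_inj/addrI/(mulfI F3).
  by rewrite [RHS](reindex_inj h_inj); apply: eq_bigr => z _; rewrite form.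
(* The inner sums no longer depend on [u], so the outer one is [#|F|] times a constant, which is 0
   in [F]. *)
have sum_const (c : F) : \sum_(x : F) c = 0.
  rewrite -[c]mulr1 -mulr_sumr; have := sum_expf F 0.
  by under eq_bigr do rewrite expr0; move=> ->; rewrite mulr0.
exact: sum_const.
Qed.

(** [h] is the Fourier matrix of order 3, invertible since 3 is nonzero. It carries the Fermat cubic
    to three times the form with [l = 6], and the factor 3 disappears in the [#|F|.-1]-th power. *)
Lemma cubic_form_sum6_root (F : finFieldType) (w : F) :
  3%:R != 0 :> F -> w ^+ 2 + w + 1 = 0 -> cubic_form_sum (6%:R : F) = cubic_form_sum 0.
Proof.
move=> F3 w_root.
pose h (t : F * F * F) : F * F * F := let: (x, y, z) := t in
  (x + y + z, x + w * y + w ^+ 2 * z, x + w ^+ 2 * y + w * z).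
have w2 : w ^+ 2 = - w - 1 by rewrite -[RHS]addr0 -w_root; ring.
have w3 : w ^+ 3 = 1 by rewrite exprS w2 mulrBr mulrN -expr2 w2; ring.
have h_inj : injective h.
  have inv x y z : [/\ 3%:R * x = (h (x, y, z)).1.1 + (h (x, y, z)).1.2 + (h (x, y, z)).2,
    3%:R * y = (h (x, y, z)).1.1 + w ^+ 2 * (h (x, y, z)).1.2 + w * (h (x, y, z)).2
    & 3%:R * z = (h (x, y, z)).1.1 + w * (h (x, y, z)).1.2 + w ^+ 2 * (h (x, y, z)).2].
    by split=> /=; ring: w2.
  move=> [[x y] z] [[x' y'] z'] hE.
  have [] := inv x y z; have [] := inv x' y' z'; rewrite hE => <- <- <-.
  by move=> /(mulfI F3)-> /(mulfI F3)-> /(mulfI F3)->.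
have pairE (l : F) : cubic_form_sum l =
    \sum_(t : F * F * F) cubic_form l t.1.1 t.1.2 t.2 ^+ #|F|.-1.
  by rewrite /cubic_form_sum pair_bigA pair_bigA.
rewrite !pairE [RHS](reindex_inj h_inj); apply: eq_bigr => -[[x y] z] _ /=.
have -> : cubic_form 0 (x + y + z) (x + w * y + w ^+ 2 * z) (x + w ^+ 2 * y + w * z) =
    3%:R * cubic_form 6%:R x y z by rewrite /cubic_form; ring: w2.
by rewrite exprMn (expf_card_pred F3) mul1r.
Qed.

(** * The sum of squared binomials at 9 *)

(** Both sides count chains of subsets of sizes [j] and [k], and vanish for [k < j]. The lower index
    [n - k] is the shape that Vandermonde's identity requires. *)
Lemma mul_bin_trinomial (n k j : nat) : (k <= n)%N -> (j <= n)%N ->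
  ('C(n, k) * 'C(k, j) = 'C(n, j) * 'C(n - j, n - k))%N.
Proof.
move=> kn jn; have [kj|jk] := ltnP k j.
  have -> : 'C(n - j, n - k) = 0%N by apply: bin_small; lia.
  by rewrite (bin_small kj) !muln0.
apply/eqP; rewrite -(eqn_pmul2r (m := j`! * (k - j)`! * (n - k)`!)) ?muln_gt0 ?fact_gt0 //.
have e1 := bin_fact kn; have e2 := bin_fact jk; have e3 := bin_fact jn.
have e4 : ('C(n - j, n - k) * ((n - k)`! * (k - j)`!) = (n - j)`!)%N.
  by rewrite -[RHS](bin_fact (m := n - k)); [congr (_ * (_ * _`!))%N; lia | lia].
apply/eqP; transitivity n`!; first by rewrite -e1 -e2; ring.
by rewrite -e3 -e4; ring.
Qed.

(** Expand [x ^+ k] in powers of [x - 1]. The coefficient of [(x - 1) ^+ j] is C(n,j) times the sum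
    of C(n,k) C(n-j,n-k), which Vandermonde evaluates as C(2n-j,n); then reverse the order of
    summation. *)
Lemma sum_sqr_bin_exp (R : comNzRingType) (n : nat) (x : R) :
  \sum_(k < n.+1) 'C(n, k)%:R ^+ 2 * x ^+ k =
  \sum_(k < n.+1) ('C(n, k) * 'C(n + k, k))%:R * (x - 1) ^+ (n - k).
Proof.
transitivity (\sum_(k < n.+1) \sum_(j < n.+1)
    ('C(n, k) * ('C(n, k) * 'C(k, j)))%:R * (x - 1) ^+ j).
  apply: eq_bigr => k _; rewrite -{1}[x](subrK 1) addrC exprDn.
  rewrite -(big_mkord predT (fun j => 1 ^+ (k - j) * (x - 1) ^+ j *+ 'C(k, j))).
  rewrite -(big_mkord predT
    (fun j => ('C(n, k) * ('C(n, k) * 'C(k, j)))%:R * (x - 1) ^+ j)).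
  rewrite [RHS](big_cat_nat (n := k.+1)) //= ?ltn_ord // [X in _ = _ + X]big_nat_cond.
  rewrite [X in _ = _ + X]big1 ?addr0 => [|j]; last first.
    by rewrite andbT => /andP[kj _]; rewrite (bin_small kj) !muln0 mul0r.
  rewrite mulr_sumr; apply: eq_bigr => j _.
  by rewrite expr1n mul1r -mulr_natr !natrM; ring.
rewrite exchange_big [RHS](reindex_inj rev_ord_inj) /=; apply: eq_bigr => j _.
rewrite subSS subKn ?leq_ord // -mulr_suml -natr_sum; congr (_%:R * _).
rewrite bin_sub ?leq_ord // -[in X in _ = (_ * X)%N]bin_sub ?leq_addl // addnK.
rewrite -binomial.Vandermonde big_distrr /=.
by apply: eq_bigr => k _; rewrite mul_bin_trinomial ?leq_ord // mulnCA.
Qed.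

(** Induction on [k]: since 3n = -1, nine times (n - k)(n + k + 1) is -(3k + 1)(3k + 2), which
    matches the new factors of the factorial next to 3(k + 1). *)
Lemma bin_mul_fact (R : comNzRingType) (n k : nat) : (3 * n + 1)%:R = 0 :> R ->
  ('C(n, k) * 'C(n + k, k))%:R * k`!%:R ^+ 3 * 27%:R ^+ k = (- 1) ^+ k * (3 * k)`!%:R :> R.
Proof.
move=> n_eq; have n3 : 3%:R * n%:R = - 1 :> R.
  by apply/eqP; rewrite -subr_eq0 opprK -natrM natr1 -addn1 n_eq.
elim: k => [|k IHk]; first by rewrite !bin0 muln0 fact0 !expr0 expr1n !mulr1.
have e1 : k.+1%:R * 'C(n, k.+1)%:R = (n%:R - k%:R) * 'C(n, k)%:R :> R.
  rewrite -natrM mul_bin_left natrM; have [kn|nk] := leqP k n; first by rewrite natrB.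
  by rewrite bin_small ?mulr0.
have e2 : k.+1%:R * 'C(n + k.+1, k.+1)%:R = (n%:R + k%:R + 1) * 'C(n + k, k)%:R :> R.
  by rewrite -natrM addnS -mul_bin_diag natrM -natr1 natrD.
have e3 : (3 * k.+1)`!%:R = (3%:R * k%:R + 1) * (3%:R * k%:R + 2%:R) *
    (3%:R * k.+1%:R) * (3 * k)`!%:R :> R.
  rewrite (_ : 3 * k.+1 = (3 * k).+3)%N; last by lia.
  have -> : 3%:R * k%:R + 1 = (3 * k).+1%:R :> R by rewrite -natrM natr1.
  have -> : 3%:R * k%:R + 2%:R = (3 * k).+2%:R :> R by rewrite -natrM -natrD addn2.
  by rewrite !factS -!natrM; congr _%:R; lia.
rewrite e3 factS !exprS.
transitivity (9%:R * (k.+1%:R * 'C(n, k.+1)%:R) * (k.+1%:R * 'C(n + k.+1, k.+1)%:R) *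
   (3%:R * k.+1%:R) * (k`!%:R ^+ 3 * 27%:R ^+ k) : R).
  by rewrite !natrM; ring.
rewrite e1 e2.
transitivity ((3%:R * n%:R - 3%:R * k%:R) * (3%:R * n%:R + 3%:R * k%:R + 3%:R) *
  (3%:R * k.+1%:R) * (('C(n, k) * 'C(n + k, k))%:R * k`!%:R ^+ 3 * 27%:R ^+ k) : R).
  by rewrite !natrM; ring.
by rewrite IHk n3; ring.
Qed.

(** The inner entries of row [p] of Pascal's triangle vanish mod [p], so consecutive entries of row
    [p.-1] are opposite. *)
Lemma bin_pred_prime (p m : nat) : prime p -> (m < p)%N ->
  'C(p.-1, m)%:R = (- 1) ^+ m :> 'F_p.
Proof.
move=> p_prime; elim: m => [|m IHm] m_lt; first by rewrite bin0.
have : 'C(p, m.+1)%:R = 0 :> 'F_p.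
  by apply/eqP; rewrite -(dvdn_pcharf (pchar_Fp p_prime)) prime_dvd_bin // m_lt.
rewrite -[in 'C(p, _)](prednK (prime_gt0 p_prime)) binS natrD IHm 1?ltnW //.
by rewrite exprS mulN1r => /eqP; rewrite addr_eq0 => /eqP.
Qed.

Lemma Fp_expf_pred (p : nat) (x : 'F_p) : prime p -> x != 0 -> x ^+ p.-1 = 1.
Proof. by move=> p_prime /expf_card_pred; rewrite card_Fp. Qed.

Lemma Fp_natr_neq0 (p m : nat) : prime p -> (0 < m < p)%N -> m%:R != 0 :> 'F_p.
Proof.
move=> p_prime /andP[m_gt0 m_lt].
by rewrite -(dvdn_pcharf (pchar_Fp p_prime)) gtnNdvd.
Qed.

Lemma Fp_fact_neq0 (p m : nat) : prime p -> (m < p)%N -> m`!%:R != 0 :> 'F_p.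
Proof.
move=> p_prime; elim: m => [|m IHm] m_lt; first by rewrite oner_eq0.
by rewrite factS natrM mulf_neq0 ?IHm ?Fp_natr_neq0 // ltnW.
Qed.

(** Expanding the left side in powers of 9 - 1 = 8 makes it agree term by term with the formula of
    [cubic_form_sumE]. *)
Lemma sum_sqr_bin_cubic_form (p n : nat) : prime p -> (3 < p)%N -> (n < p)%N ->
  (3 * n + 1)%:R = 0 :> 'F_p ->
  \sum_(k < n.+1) 'C(n, k)%:R ^+ 2 * 9%:R ^+ k =
  - (8%:R ^+ n * cubic_form_sum 6%:R) :> 'F_p.
Proof.
move=> p_prime p_gt3 n_lt n_eq.
have two0 : 2%:R != 0 :> 'F_p by apply: Fp_natr_neq0 => //; lia.
have three0 : 3%:R != 0 :> 'F_p by apply: Fp_natr_neq0.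
have six0 : 6%:R != 0 :> 'F_p by rewrite (natrM _ 2 3) mulf_neq0.
have eight0 : 8%:R != 0 :> 'F_p by rewrite (natrX _ 2 3) expf_neq0.
have twentyseven0 : 27%:R != 0 :> 'F_p by rewrite (natrX _ 3 3) expf_neq0.
pose u k : 'F_p := ('C(n, k) * 'C(n + k, k))%:R.
rewrite cubic_form_sumE mulrN opprK card_Fp // prednK ?prime_gt0 // sum_sqr_bin_exp.
have term j : (j < p)%N ->
    ('C(p.-1, 3 * j) * ('C(3 * j, 2 * j) * 'C(2 * j, j)))%:R * 6%:R ^+ (p.-1 - 3 * j) =
    u j / 8%:R ^+ j.
  move=> j_lt; have fj := Fp_fact_neq0 p_prime j_lt.
  have fj3 : j`!%:R ^+ 3 * 27%:R ^+ j != 0 :> 'F_p by rewrite mulf_neq0 ?expf_neq0.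
  have uE : u j = (- 1) ^+ j * (3 * j)`!%:R / (j`!%:R ^+ 3 * 27%:R ^+ j).
    by rewrite -(bin_mul_fact j n_eq) -mulrA mulfK.
  (* When [3 * j >= p] the binomial on the left is 0, while on the right [p] divides [(3 * j)!] but
     not [j!]. *)
  have [j3|j3] := leqP (3 * j) p.-1; last first.
    rewrite (bin_small j3) mul0n mul0r uE.
    suff -> : (3 * j)`!%:R = 0 :> 'F_p by rewrite mulr0 !mul0r.
    apply/eqP; rewrite -(dvdn_pcharf (pchar_Fp p_prime)) dvdn_fact //.
    by rewrite prime_gt0 //=; lia.
  have factE : (3 * j)`!%:R = ('C(3 * j, 2 * j) * 'C(2 * j, j))%:R * j`!%:R ^+ 3 :> 'F_p.
    rewrite -natrX -natrM -(bin_fact (n := 3 * j) (m := 2 * j)); last by lia.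
    rewrite -[(2 * j)`!](bin_fact (n := 2 * j) (m := j)); last by lia.
    have -> : (3 * j - 2 * j = j)%N by lia.
    have -> : (2 * j - j = j)%N by lia.
    by congr _%:R; ring.
  (* Fermat's little theorem together with 6^3 = 8 * 27. *)
  have six_pow : 6%:R ^+ (p.-1 - 3 * j) * (8%:R ^+ j * 27%:R ^+ j) = 1 :> 'F_p.
    rewrite -exprMn -natrM (natrX _ 6 3) -exprM -exprD subnK //.
    exact: Fp_expf_pred.
  rewrite natrM bin_pred_prime //; last by lia.
  apply: (mulIf (expf_neq0 j eight0)); rewrite mulfVK ?expf_neq0 //.
  apply: (mulIf fj3); rewrite uE mulfVK // factE.
  have -> : (- 1) ^+ (3 * j) = (- 1) ^+ j :> 'F_p by rewrite exprM; congr (_ ^+ j); ring.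
  rewrite -[RHS]mulr1 -[X in _ = _ * X]six_pow.
  move: (_ ^+ (_ - _)) (8%:R ^+ j) (27%:R ^+ j) => a b c.
  by move: (_ `!%:R) (_ * _)%:R => d e; ring.
have u_small j : (n < j)%N -> u j = 0 by move=> nj; rewrite /u bin_small.
rewrite [in RHS](eq_big_nat _ _ (F2 := fun j => u j / 8%:R ^+ j)) => [|j /andP[_ /term]] //.
rewrite [in RHS](big_nat_vanish n_lt) => [|j nj]; last by rewrite u_small ?mul0r.
rewrite mulr_sumr; apply: eq_bigr => k _.
have -> : 9%:R - 1 = 8%:R :> 'F_p by ring.
have -> : 8%:R ^+ n = 8%:R ^+ (n - k) * 8%:R ^+ k :> 'F_p.
  by rewrite -exprD subnK // leq_ord.
by rewrite -/(u k) [RHS]mulrCA -mulrA mulfV ?expf_neq0 ?mulr1.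
Qed.

(** * Jacobi sums of cubic characters *)

(* J(chi, chi) times its conjugate, for chi of order 3; the substitution s = t u turns the
   double sum into sums of chi over Moebius images of the line. *)
Lemma jacobi_sum_norm (F : finFieldType) (R : comNzRingType) (chi : F -> R) :
  {morph chi : x y / x * y} -> chi 0 = 0 ->
  (forall x, x != 0 -> chi x ^+ 3 = 1) ->
  \sum_x chi x = 0 -> \sum_x chi x ^+ 2 = 0 ->
  (\sum_t chi (t * (1 - t))) * (\sum_t chi (t * (1 - t)) ^+ 2) = #|F|%:R.
Proof.
move=> chiM chi0 chi3 sum_chi sum_chi2.
have chi1 : chi 1 = 1.
  by have := chi3 1 (oner_neq0 F); rewrite exprS expr2 -!chiM !mulr1.
have chiV r : r != 0 -> chi r ^+ 2 = chi r^-1.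
  move=> r0; rewrite -[LHS]mulr1 -chi1 -(mulfV r0) chiM.
  by rewrite mulrA -exprSr chi3 // mul1r.
pose K u := \sum_r chi r ^+ 2 * chi (1 - u + r * u).
(* For [r != 0] the term is [chi] at (1 - u)/r + u. With [s = r^-1] the sum runs over an affine line
   without the point [s = 0], whose value is [chi u]; the full line gives 0 unless [u = 1]. *)
have KE u : K u = (if u == 1 then #|F|%:R else 0) - chi u.
  rewrite /K (bigD1 0) //= chi0 expr2 !mul0r add0r.
  transitivity (\sum_(s | s != 0) chi ((1 - u) * s + u)).
    rewrite [RHS](reindex_inj invr_inj) /=; apply: eq_big => [r|r r0].
      by rewrite invr_eq0.
    by rewrite chiV // -chiM; congr chi; field.
  have -> : \sum_(s | s != 0) chi ((1 - u) * s + u) = \sum_s chi ((1 - u) * s + u) - chi u.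
    by rewrite [in RHS](bigD1 0) //= mulr0 add0r addrAC subrr add0r.
  congr (_ - _); have [->|u1] := eqVneq u 1.
    rewrite (eq_bigr (fun=> 1)) => [|s _]; last by rewrite subrr mul0r add0r.
    by rewrite sumr_const.
  have u1' : 1 - u != 0 by rewrite subr_eq0 eq_sym.
  rewrite -[RHS]sum_chi [RHS](reindex_inj (addIr u)) /=.
  by rewrite [RHS](reindex_inj (mulfI u1')).
(* After [s = t u] the factor [chi t ^+ 3 = 1] drops out, and [r = 1 - t] turns the inner sum into
   [K u] deprived of its term at [t = 0], which is 1. *)
transitivity (\sum_u chi u * (K u - 1)).
  rewrite mulrC big_distrl /=.
  transitivity (\sum_t \sum_u (if t == 0 then 0 else chi u * (chi (1 - t) ^+ 2 * chi (1 - t * u)))).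
    apply: eq_bigr => t _; have [->|t0] := eqVneq t 0.
      by rewrite mul0r chi0 expr2 !mul0r big1.
    rewrite (reindex_inj (mulfI t0)) mulr_sumr /=; apply: eq_bigr => u _.
    rewrite !chiM exprMn.
    by rewrite -[RHS]mul1r -(chi3 t t0) exprS; ring.
  rewrite exchange_big /=; apply: eq_bigr => u _.
  rewrite (bigD1 0) //= eqxx add0r.
  rewrite (eq_bigr (fun t => chi u * (chi (1 - t) ^+ 2 * chi (1 - t * u)))); last first.
    by move=> t /negPf->.
  rewrite -mulr_sumr; congr (_ * _).
  have -> : K u = \sum_t chi (1 - t) ^+ 2 * chi (1 - t * u).
    have sub_inj : injective (fun t : F => 1 - t) by move=> a b /addrI/oppr_inj.
    rewrite /K (reindex_inj sub_inj); apply: eq_bigr => t _.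
    by congr (_ * chi _); ring.
  by rewrite [in RHS](bigD1 0) //= subr0 mul0r subr0 chi1 expr1n mul1r addrAC subrr add0r.
rewrite (eq_bigr (fun u => (if u == 1 then #|F|%:R else 0) - chi u ^+ 2 - chi u)).
  rewrite !big_split /= !sumrN sum_chi sum_chi2 !subr0 -big_mkcond /=.
  by rewrite big_pred1_eq.
move=> u _; rewrite KE; case: eqP => [->|_]; first by rewrite chi1; ring.
by ring.
Qed.

(** Every orbit of [f] in [A] has exactly three elements, and [fcard f A] is the number of
    orbits. *)
Lemma dvdn3_card (T : finType) (f : T -> T) (A : {pred T}) :
  injective f -> (forall x, x \in A -> f (f (f x)) = x) ->
  (forall x, x \in A -> f x \in A) -> (forall x, x \in A -> f x != x) ->
  (3 %| #|A|)%N.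
Proof.
move=> f_inj f3 fA fneq; apply/dvdnP; exists (fcard f A).
rewrite -(@fcard_order_set _ _ f_inj 3 A) //; last first.
  by apply: (intro_closed (fconnect_sym f_inj)) => x y /eqP <-; exact: fA.
apply/subsetP => x xA; rewrite inE.
have cyc : fcycle f [:: x; f x; f (f x)] by rewrite /= !eqxx f3 ?eqxx.
rewrite (order_cycle cyc) ?inE ?eqxx //= !inE !negb_or andbT.
rewrite eq_sym fneq //= [f x == _]eq_sym fneq ?fA // andbT.
by apply/eqP => /(congr1 f)/eqP; rewrite f3 //; exact/negP/fneq.
Qed.

(** The cube of [g ^+ n] is 1 by Fermat, so [g ^+ n] is a primitive cube root of unity. The element
    [g] is kept because multiplication by it makes character sums vanish. *)
Lemma exists_cubic_root (F : finFieldType) (n : nat) : #|F|.-1 = (3 * n)%N ->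
  exists g : F, [/\ g != 0, g ^+ n != 1 & (g ^+ n) ^+ 2 + g ^+ n + 1 = 0].
Proof.
move=> card_F; have F_gt1 := card_finNzRing_gt1 F.
have : ~~ (#|F|.-1 %| n)%N.
  rewrite card_F; apply/negP => /dvdn_leq; move: card_F; move: (#|F|) F_gt1 => N; lia.
move=> /exists_expf_neq1[g g0 gn1]; exists g; split=> //.
apply: (mulfI (x := g ^+ n - 1)); first by rewrite subr_eq0.
rewrite mulr0; transitivity ((g ^+ n) ^+ 3 - 1); first by ring.
by rewrite -exprM mulnC -card_F expf_card_pred // subrr.
Qed.

(** With [m = n] and [m = 2 * n], where [#|F|.-1 = 3 * n], these sums are the images in [F] of two
    conjugate Jacobi sums. *)
Lemma sum_sqr_line (F : finFieldType) (m : nat) :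
  \sum_(t : F) (t * (1 - t)) ^+ m =
  \sum_(i < m.+1) (- 1) ^+ i * 'C(m, i)%:R *
     (if (0 < m + i)%N && (#|F|.-1 %| m + i)%N then -1 else 0).
Proof.
transitivity (\sum_(t : F) \sum_(i < m.+1) (- 1) ^+ i * 'C(m, i)%:R * t ^+ (m + i)).
  apply: eq_bigr => t _; rewrite exprMn exprDn mulr_sumr; apply: eq_bigr => i _.
  by rewrite expr1n mul1r (exprNn t) mulrnAr -mulr_natr exprD; ring.
by rewrite exchange_big; apply: eq_bigr => i _; rewrite -mulr_sumr sum_expf.
Qed.

(** The Jacobi sum J of a cubic character is [N 0 + N 1 z + N 2 z^2], where [N i] counts the [t]
    with [(t (1 - t)) ^+ n = w ^+ i]. Its norm [#|F|] gives the quadratic form, and sending [z] to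
    [w] gives the value of its trace in [F]. *)
Lemma gauss_cubic (F : finFieldType) (n : nat) : #|F|.-1 = (3 * n)%N ->
  exists L M : int, [/\ (4 * #|F|)%:Z = L ^+ 2 + 27 * M ^+ 2, (3 %| L - 2)%Z &
    L%:~R = 'C(2 * n, n)%:R :> F].
Proof.
move=> card_F; have F_gt1 := card_finNzRing_gt1 F.
have n_gt0 : (0 < n)%N by move: card_F; move: (#|F|) F_gt1 => N; lia.
have [g [g0]] := exists_cubic_root card_F.
move gn_w: (g ^+ n) => w gn1 g_root.
have [z z_prim] := C_prim_root_exists (isT : (0 < 3)%N).
have w0 : w != 0 by rewrite -gn_w expf_neq0.
have w3 : w ^+ 3 = 1.
  apply/eqP; rewrite -subr_eq0 -[X in _ == X](mulr0 (w - 1)) -g_root; apply/eqP.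
  by ring.
have z3 : z ^+ 3 = 1 := prim_expr_order z_prim.
have z1 : z != 1 by rewrite -[z]expr1 -(prim_order_dvd z_prim).
have z2 : z ^+ 2 != 1 by rewrite -(prim_order_dvd z_prim).
have z_root : z ^+ 2 + z + 1 = 0.
  apply: (mulfI (x := z - 1)); first by rewrite subr_eq0.
  by rewrite mulr0; transitivity (z ^+ 3 - 1); [ring | rewrite z3 subrr].
have ww : (w ^+ 2 == w) = false.
  by apply: contraNF gn1 => /eqP ww; apply/eqP/(mulfI w0); rewrite mulr1 -expr2.
have w2 : (w ^+ 2 == 1) = false.
  by apply: contraNF gn1 => /eqP w2; rewrite -w3 exprSr w2 mul1r.
(* Carries the cube roots of unity of [F] to those of [algC], and everything else to 0; composed
   with the [n]-th power it is a cubic character. *)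
pose ka (y : F) : algC := (y == 1)%:R + (y == w)%:R * z + (y == w ^+ 2)%:R * z ^+ 2.
have ka0 : ka 0 = 0.
  by rewrite /ka ![0 == _]eq_sym oner_eq0 !expf_eq0 (negPf w0) /=; ring.
have ka1 : ka 1 = 1.
  by rewrite /ka eqxx ![1 == _]eq_sym w2 (negPf gn1) /=; ring.
have kaw : ka w = z.
  by rewrite /ka eqxx [w == w ^+ 2]eq_sym ww (negPf gn1) /=; ring.
have kaw2 : ka (w ^+ 2) = z ^+ 2 by rewrite /ka eqxx ww w2 /=; ring.
have root_cases (x : F) : x != 0 -> [\/ x ^+ n = 1, x ^+ n = w | x ^+ n = w ^+ 2].
  move=> x0; have : (x ^+ n - 1) * (x ^+ n - w) * (x ^+ n - w ^+ 2) == 0.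
    have x3 : (x ^+ n) ^+ 3 = 1 by rewrite -exprM mulnC -card_F expf_card_pred.
    have -> : w ^+ 2 = - w - 1 by rewrite -[RHS]addr0 -g_root; ring.
    apply/eqP; transitivity ((x ^+ n) ^+ 3 - 1 - (x ^+ n - 1) * (w ^+ 2 + w + 1)); first by ring.
    by rewrite x3 g_root; ring.
  rewrite !mulf_eq0 !subr_eq0 => /orP[/orP[]|] /eqP ->; [exact: Or31|exact: Or32|exact: Or33].
pose chi (x : F) := ka (x ^+ n).
have chi0 : chi 0 = 0 by rewrite /chi expr0n eqn0Ngt n_gt0.
have chiM : {morph chi : x y / x * y}.
  move=> x y; have [->|x0] := eqVneq x 0; first by rewrite mul0r chi0 mul0r.
  have [->|y0] := eqVneq y 0; first by rewrite mulr0 chi0 mulr0.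
  rewrite /chi exprMn; case: (root_cases x x0) => ->; case: (root_cases y y0) => ->;
    rewrite ?ka1 ?kaw ?kaw2 ?mul1r ?mulr1 ?ka1 ?kaw ?kaw2 // -?expr2 -?exprSr -?exprS
      ?w3 ?z3 ?ka1 //.
  by rewrite -!exprM -[(2 * 2)%N]/4%N !(exprSr _ 3) w3 z3 !mul1r kaw.
have chi3 x : x != 0 -> chi x ^+ 3 = 1.
  move=> /root_cases; rewrite /chi => -[] ->; rewrite ?ka1 ?kaw ?kaw2 ?expr1n //.
  by rewrite -exprM mulnC exprM z3 expr1n.
have chig : chi g = z by rewrite /chi gn_w kaw.
have sum0 (f : F -> algC) : (forall x, f (g * x) = f g * f x) -> f g != 1 ->
    \sum_x f x = 0.
  move=> fM fg; apply: (mulfI (x := f g - 1)); first by rewrite subr_eq0.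
  rewrite mulr0 mulrBl mul1r [X in _ - X](reindex_inj (mulfI g0)) /= mulr_sumr.
  by rewrite (eq_bigr _ (fun x _ => esym (fM x))) subrr.
have sum_chi : \sum_x chi x = 0 by apply: sum0 => [x|]; rewrite ?chiM ?chig.
have sum_chi2 : \sum_x chi x ^+ 2 = 0.
  by apply: (sum0 (fun x => chi x ^+ 2)) => [x|]; rewrite ?chiM ?exprMn ?chig.
have norm := jacobi_sum_norm chiM chi0 chi3 sum_chi sum_chi2.
pose y (t : F) := (t * (1 - t)) ^+ n.
pose N i := #|[pred t | y t == w ^+ i]|.
(* Generic in the ring, since the same counts appear in [int], in [algC] and in [F]. *)
have sumN (R : nzRingType) i : \sum_t (y t == w ^+ i)%:R = (N i)%:R :> R.
  rewrite /N -sum1_card natr_sum [RHS]big_mkcond /=; apply: eq_bigr => t _.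
  by rewrite inE; case: eqP.
have y0 t : (y t != 0) = (t != 0) && (t != 1).
  by rewrite /y expf_eq0 n_gt0 /= mulf_eq0 negb_or subr_eq0 [1 == t]eq_sym.
have y_cases t : y t != 0 -> [\/ y t = 1, y t = w | y t = w ^+ 2].
  by rewrite /y expf_eq0 n_gt0 /=; exact: root_cases.
have ind (R : nzRingType) (a b c : R) t :
    (y t == w ^+ 0)%:R * a + (y t == w ^+ 1)%:R * b + (y t == w ^+ 2)%:R * c =
    if y t == 1 then a else if y t == w then b else if y t == w ^+ 2 then c else 0.
  rewrite expr0 expr1; have [->|_] := eqVneq (y t) 1.
    by rewrite ![1 == _]eq_sym w2 (negPf gn1) !mul0r mul1r !addr0.
  have [->|_] := eqVneq (y t) w.
    by rewrite [w == w ^+ 2]eq_sym ww !mul0r mul1r add0r addr0.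
  by case: eqP => _; rewrite ?mul0r ?mul1r ?add0r ?addr0.
have sum_ind (R : nzRingType) (a b c : R) :
    \sum_t (if y t == 1 then a else if y t == w then b else if y t == w ^+ 2 then c else 0) =
    (N 0)%:R * a + (N 1)%:R * b + (N 2)%:R * c.
  by rewrite -!sumN !mulr_suml -!big_split; apply: eq_bigr => t _; rewrite -ind.
(* The 2 stands for [t = 0] and [t = 1], the only zeros of [y]. *)
have N_sum : (N 0 + N 1 + N 2 + 2 = #|F|)%N.
  have F_split : #|F| = #|[pred t | y t != 0]|.+2.
    rewrite (cardD1 0) (cardD1 1) !inE oner_eq0 /= !add1n; congr _.+2.
    by apply: eq_card => t; rewrite !inE y0 !andbT andbC.
  rewrite F_split addn2; congr _.+2; apply/eqP.
  rewrite -(eqr_nat int) !natrD -[(N 0)%:R]mulr1 -[(N 1)%:R]mulr1 -[(N 2)%:R]mulr1.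
  rewrite -sum_ind -sum1_card natr_sum [X in _ == X]big_mkcond /=; apply/eqP.
  apply: eq_bigr => t _; rewrite inE; have [->|yt0] := eqVneq (y t) 0.
    by rewrite ![0 == _]eq_sym oner_eq0 expf_eq0 (negPf w0).
  by case: (y_cases t yt0) => ->; rewrite ?eqxx ?w2 ?ww ?(negPf gn1).
have J1 : \sum_t chi (t * (1 - t)) = (N 0)%:R + (N 1)%:R * z + (N 2)%:R * z ^+ 2.
  rewrite -[(N 0)%:R]mulr1 -sum_ind; apply: eq_bigr => t _.
  by rewrite -ind expr0 expr1 mulr1.
have J2 : \sum_t chi (t * (1 - t)) ^+ 2 = (N 0)%:R + (N 1)%:R * z ^+ 2 + (N 2)%:R * z.
  rewrite -[(N 0)%:R]mulr1 -sum_ind; apply: eq_bigr => t _.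
  rewrite /chi -/(y t); have [->|yt0] := eqVneq (y t) 0.
    rewrite ka0 ![0 == _]eq_sym oner_eq0 expf_eq0 (negPf w0) /=; ring.
  case: (y_cases t yt0) => ->; rewrite ?ka1 ?kaw ?kaw2 ?eqxx ?w2 ?ww ?(negPf gn1); first by ring.
    by [].
  by rewrite -exprM -[(2 * 2)%N]/4%N (exprSr _ 3) z3 mul1r.
have Fsum1 : (N 0)%:R + (N 1)%:R * w + (N 2)%:R * w ^+ 2 = 0 :> F.
  rewrite -[(N 0)%:R]mulr1 -sum_ind; transitivity (\sum_t y t).
    apply: eq_bigr => t _; have [->|yt0] := eqVneq (y t) 0.
      by rewrite ![0 == _]eq_sym oner_eq0 expf_eq0 (negPf w0).
    by case: (y_cases t yt0) => ->; rewrite ?eqxx ?w2 ?ww ?(negPf gn1).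
  (* The exponents [n + i] lie between [n] and [2 * n], so none is a multiple of [3 * n]. *)
  rewrite /y sum_sqr_line big1 // => i _; rewrite card_F ifN ?mulr0 //.
  apply/negP => /andP[ni_gt0 /(dvdn_leq ni_gt0)]; have := leq_ord i.
  by clear -n_gt0; lia.
have Fsum2 : (N 0)%:R + (N 1)%:R * w ^+ 2 + (N 2)%:R * w = - 'C(2 * n, n)%:R :> F.
  rewrite -[(N 0)%:R]mulr1 -sum_ind; transitivity (\sum_t y t ^+ 2).
    apply: eq_bigr => t _; have [->|yt0] := eqVneq (y t) 0.
      by rewrite expr0n ![0 == _]eq_sym oner_eq0 expf_eq0 (negPf w0).
    case: (y_cases t yt0) => ->; rewrite ?expr1n ?eqxx ?w2 ?ww ?(negPf gn1) //.
    by rewrite -exprM -[(2 * 2)%N]/4%N (exprSr _ 3) w3 mul1r.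
  under eq_bigr do rewrite /y -exprM mulnC.
  (* The exponents now lie between [2 * n] and [4 * n], and only [i = n] gives a multiple of
     [3 * n]; the sign there is 1, since -1 is its own cube. *)
  rewrite sum_sqr_line.
  have lt_n2 : (n < (2 * n).+1)%N by rewrite ltnS leq_pmull.
  rewrite (bigD1 (Ordinal lt_n2)) //= card_F big1 => [|i /eqP/val_eqP /= i_n].
    have -> : (- 1) ^+ n = 1 :> F.
      have m1 : (- 1) ^+ #|F|.-1 = 1 :> F by rewrite expf_card_pred // oppr_eq0 oner_eq0.
      by rewrite -[RHS]m1 card_F exprM; congr (_ ^+ n); ring.
    rewrite -[X in (_ + X)%N]mul1n -mulnDl dvdnn.
    by rewrite muln_gt0 n_gt0 /= addr0; ring.
  rewrite ifN ?mulr0 //; apply/negP => /andP[_ /dvdnP[k]]; have := leq_ord i.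
  by clear -n_gt0 i_n; case: k => [|[|k]]; nia.
(* t |-> 1/(1 - t) has order 3 and multiplies t(1 - t) by a cube; t(1 - t) = 1 at its
   fixed points. *)
have N3 i : w ^+ i != 1 -> (3 %| N i)%N.
  move=> wi; have wi0 : w ^+ i != 0 by rewrite expf_neq0.
  have A01 t : y t == w ^+ i -> (t != 0) && (1 - t != 0).
    by rewrite subr_eq0 [1 == t]eq_sym -y0 => /eqP->.
  apply: (@dvdn3_card _ (fun t : F => (1 - t)^-1)).
  - by move=> a b /invr_inj/addrI/oppr_inj.
  - move=> t; rewrite inE => /A01/andP[t0 t1].
    have t1' : 1 - (1 - t)^-1 = - t / (1 - t) by field.
    have t2' : 1 - (1 - t) / (- t) = t^-1 by field; rewrite oppr_eq0 t0.
    by rewrite t1' invf_div t2' invrK.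
  - move=> t; rewrite !inE => /[dup] /A01/andP[t0 t1] /eqP <-; apply/eqP.
    have -> : y t = y t * (- (1 - t)^-1) ^+ (3 * n).
      by rewrite -card_F expf_card_pred ?mulr1 // oppr_eq0 invr_eq0.
    by rewrite /y exprM -exprMn; congr (_ ^+ n); field.
  - move=> t; rewrite inE => /[dup] /A01/andP[t0 t1] yt.
    apply: contra wi => /eqP ft; rewrite -(eqP yt) /y.
    by rewrite -{1}ft mulVf // expr1n.
have Nnorm : (N 0 * N 0 + N 1 * N 1 + N 2 * N 2 =
    #|F| + N 0 * N 1 + N 0 * N 2 + N 1 * N 2)%N.
  apply/eqP; rewrite -(eqr_nat algC) !natrD !natrM -norm J1 J2 -subr_eq0.
  move: (N 0)%:R (N 1)%:R (N 2)%:R => A B C; apply/eqP.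
  (* The cofactor is the quotient by [z ^+ 2 + z + 1] of the difference of the two sides, as
     polynomials in [z]. *)
  transitivity (- ((B ^+ 2 + C ^+ 2) * (z - 1) + A * B + A * C + B * C * (z ^+ 2 - z + 1)) *
    (z ^+ 2 + z + 1)); first by ring.
  by rewrite z_root mulr0.
have /dvdnP[a Na] : (3 %| N 1)%N by apply: N3; rewrite expr1.
have /dvdnP[b Nb] : (3 %| N 2)%N by apply: N3; rewrite w2.
(* L is minus the trace of J, and M is a third of [N 1 - N 2], since four times the norm is L^2 + 3
   (N 1 - N 2)^2. Mod 3, [N_sum] gives [N 0 = 2], hence [L = 2]. *)
exists ((N 1)%:Z + (N 2)%:Z - 2 * (N 0)%:Z), (a%:Z - b%:Z); split.
- by move: (N 0) (N 1) (N 2) (#|F|) Na Nb Nnorm => N0 N1 N2 NF -> ->; nia.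
- move: card_F N_sum; move: (N 0) (N 1) (N 2) (#|F|) F_gt1 => N0 N1 N2 NF; lia.
- rewrite -[RHS]opprK -Fsum2 intrB intrD intrM -!pmulrn; move: Fsum1.
  move: (N 0)%:R (N 1)%:R (N 2)%:R => A B C ABC; apply/eqP; rewrite -subr_eq0; apply/eqP.
  transitivity ((B + C) * (w ^+ 2 + w + 1) - (A + B * w + C * w ^+ 2)); first by ring.
  by rewrite g_root ABC mulr0 subr0.
Qed.

(** [p] divides (LB)^2 - (AM)^2, hence LB - AM after a possible change of sign of B.
    Multiplicativity of the form bounds 27 (LB - AM)^2 by 16 p^2, so LB = AM and L = A or L = -A;
    the residues mod 3 exclude the latter. *)
Lemma quad_form_unique (p : nat) (A B L M : int) : prime p ->
  (4 * p)%:Z = A ^+ 2 + 27 * B ^+ 2 -> (4 * p)%:Z = L ^+ 2 + 27 * M ^+ 2 ->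
  (3 %| A - 2)%Z -> (3 %| L - 2)%Z -> L = A.
Proof.
move=> p_prime; have p_gt0 := prime_gt0 p_prime; rewrite PoszM.
move=> AB LM A3 L3.
(* Stated for a separate [B'] so that it applies to both [B] and [- B]. *)
have sqr_eq (B' : int) : (4 * p%:Z) = A ^+ 2 + 27 * B' ^+ 2 ->
    (p%:Z %| L * B' - A * M)%Z -> L ^+ 2 = A ^+ 2.
  move=> AB' /dvdzP[k k_eq].
  have brahmagupta : (L * A + 27 * M * B') ^+ 2 + 27 * (k * p%:Z) ^+ 2 = 16 * p%:Z ^+ 2.
    rewrite -k_eq; transitivity ((L ^+ 2 + 27 * M ^+ 2) * (A ^+ 2 + 27 * B' ^+ 2)); first by ring.
    by rewrite -AB' -LM; ring.
  have k0 : k = 0.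
    have k_small : 27 * k ^+ 2 <= 16.
      rewrite -(ler_pM2r (x := p%:Z ^+ 2)) ?exprn_gt0 //.
      have -> : 27 * k ^+ 2 * p%:Z ^+ 2 = 27 * (k * p%:Z) ^+ 2 by ring.
      by rewrite -brahmagupta lerDr sqr_ge0.
    apply/eqP; rewrite -sqrf_eq0; move: k_small (sqr_ge0 k); clear.
    by move: (k ^+ 2) => s; lia.
  have LB : L * B' = A * M by apply/eqP; rewrite -subr_eq0 k_eq k0 mul0r.
  have : 4 * p%:Z * (B' ^+ 2 - M ^+ 2) == 0.
    apply/eqP; transitivity ((L ^+ 2 + 27 * M ^+ 2) * B' ^+ 2 - (A ^+ 2 + 27 * B' ^+ 2) * M ^+ 2).
      by rewrite -LM -AB'; ring.
    by transitivity ((L * B') ^+ 2 - (A * M) ^+ 2); [ring | rewrite LB subrr].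
  rewrite mulf_eq0 subr_eq0 => /orP[|/eqP BM]; first by rewrite mulf_eq0 eqz_nat; clear -p_gt0; lia.
  by move: AB'; rewrite LM BM => /addIr.
have : (p%:Z %| (L * B - A * M) * (L * - B - A * M))%Z.
  apply/dvdzP; exists (- 4 * (B ^+ 2 - M ^+ 2)).
  transitivity ((A ^+ 2 + 27 * B ^+ 2) * M ^+ 2 - (L ^+ 2 + 27 * M ^+ 2) * B ^+ 2); first by ring.
  by rewrite -AB -LM; ring.
have L2 : L ^+ 2 = A ^+ 2 -> L = A.
  move=> /eqP; rewrite eqf_sqr => /orP[/eqP // | /eqP L_eq].
  by move: L3 A3; rewrite L_eq; clear; lia.
rewrite dvdzE abszM Euclid_dvdM // => /orP[] pd; apply: L2.
  exact: (sqr_eq B).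
by apply: (sqr_eq (- B)); rewrite ?sqrrN.
Qed.

(** * Reduction of rationals modulo p *)

(** Reduction is a relation witnessed by any fraction, not necessarily in lowest terms, so that
    closure under the field operations follows from the usual formulas for fractions. *)
Definition reduces_to (p : nat) (x : rat) (a : 'F_p) : Prop :=
  exists m d : int, [/\ d%:~R != 0 :> 'F_p, x = m%:~R / d%:~R & a = m%:~R / d%:~R].

Lemma reduces_to_den_neq0 (p : nat) (d : int) :
  d%:~R != 0 :> 'F_p -> d%:~R != 0 :> rat.
Proof. by rewrite intr_eq0; apply: contraNneq => ->. Qed.

Lemma reduces_to_int (p : nat) (m : int) : reduces_to m%:~R (m%:~R : 'F_p).
Proof. by exists m, 1; rewrite !divr1 oner_eq0. Qed.

Lemma reduces_to_nat (p m : nat) : reduces_to m%:R (m%:R : 'F_p).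
Proof. by have := reduces_to_int p m. Qed.

Lemma reduces_toD (p : nat) (x y : rat) (a b : 'F_p) :
  reduces_to x a -> reduces_to y b -> reduces_to (x + y) (a + b).
Proof.
move=> [m [d [d0 -> ->]]] [m' [d' [d'0 -> ->]]].
have dR := reduces_to_den_neq0 d0; have d'R := reduces_to_den_neq0 d'0.
exists (m * d' + m' * d), (d * d').
by rewrite !(intrD, intrM) mulf_neq0 // !addf_div.
Qed.

Lemma reduces_toM (p : nat) (x y : rat) (a b : 'F_p) :
  reduces_to x a -> reduces_to y b -> reduces_to (x * y) (a * b).
Proof.
move=> [m [d [d0 -> ->]]] [m' [d' [d'0 -> ->]]].
by exists (m * m'), (d * d'); rewrite !intrM mulf_neq0 // !mulf_div.
Qed.

Lemma reduces_toN (p : nat) (x : rat) (a : 'F_p) :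
  reduces_to x a -> reduces_to (- x) (- a).
Proof. by move=> [m [d [d0 -> ->]]]; exists (- m), d; rewrite !intrN !mulNr. Qed.

Lemma reduces_toV (p : nat) (x : rat) (a : 'F_p) :
  a != 0 -> reduces_to x a -> reduces_to x^-1 a^-1.
Proof.
move=> a0 [m [d [d0 -> a_eq]]]; exists d, m; rewrite a_eq !invf_div; split=> //.
by apply: contraNneq a0 => m0; rewrite a_eq m0 mul0r.
Qed.

Lemma reduces_toX (p n : nat) (x : rat) (a : 'F_p) :
  reduces_to x a -> reduces_to (x ^+ n) (a ^+ n).
Proof.
move=> xa; elim: n => [|n IHn]; first exact: (reduces_to_nat p 1).
by rewrite !exprS; apply: reduces_toM.
Qed.

Lemma reduces_to_sum (p : nat) (I : eqType) (r : seq I) (f : I -> rat) (g : I -> 'F_p) :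
  (forall i, i \in r -> reduces_to (f i) (g i)) ->
  reduces_to (\sum_(i <- r) f i) (\sum_(i <- r) g i).
Proof.
move=> fg; elim: r fg => [|i r IHr] fg; first by rewrite !big_nil; exact: (reduces_to_nat p 0).
rewrite !big_cons; apply: reduces_toD; first by apply: fg; rewrite mem_head.
by apply: IHr => j jr; apply: fg; rewrite inE jr orbT.
Qed.

Lemma reduces_to_prod (p n : nat) (f : nat -> rat) (g : nat -> 'F_p) :
  (forall i, reduces_to (f i) (g i)) ->
  reduces_to (\prod_(i < n) f i) (\prod_(i < n) g i).
Proof.
move=> fg; elim: n => [|n IHn]; first by rewrite !big_ord0; exact: (reduces_to_nat p 1).
by rewrite !big_ord_recr; apply: reduces_toM.
Qed.

Lemma numq_cross (x : rat) (m d : int) : d != 0 -> x = m%:~R / d%:~R ->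
  numq x * d = m * denq x.
Proof.
move=> d0 x_eq; apply/eqP; rewrite -(eqr_int rat) !intrM; apply/eqP.
have dR : d%:~R != 0 :> rat by rewrite intr_eq0.
have nR : (denq x)%:~R != 0 :> rat by rewrite intr_eq0 denq_neq0.
by rewrite numqE {1}x_eq mulrAC divfK.
Qed.

(** For [x = m / d] with [d] prime to [p], the lowest-terms denominator divides [d], and
    cross-multiplication transfers divisibility by [p] from [m] to the numerator. *)
Lemma reduces_to_congr (p : nat) (x y : rat) (a : 'F_p) : prime p ->
  reduces_to x a -> reduces_to y a -> rat_congr p x y.
Proof.
move=> p_prime xa ya; have pF (m : int) : (p%:Z %| m)%Z = (m%:~R == 0 :> 'F_p).
  exact: dvdz_pcharf (pchar_Fp p_prime) m.
have cross (z : rat) (m d : int) : d%:~R != 0 :> 'F_p -> z = m%:~R / d%:~R ->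
    numq z * d = m * denq z.
  by move=> d0; apply: numq_cross; have := reduces_to_den_neq0 d0; rewrite intr_eq0.
have integral z (b : 'F_p) : reduces_to z b -> mod_integral p z.
  move=> [m [d [d0 z_eq _]]]; rewrite /mod_integral prime_coprime //.
  have num_den := cross z m d d0 z_eq.
  apply: contra d0 => p_den; rewrite -pF dvdzE /=.
  have : (`|denq z| %| `|numq z| * `|d|)%N.
    by rewrite -abszM num_den abszM dvdn_mull.
  rewrite Gauss_dvdr; first exact: dvdn_trans.
  by rewrite coprime_sym coprime_num_den.
split; [exact: integral xa | exact: integral ya |].
have [m [d [d0 xy_eq ab]]] := reduces_toD xa (reduces_toN ya).
have pm : (p%:Z %| m)%Z.
  by rewrite pF -[_%:~R](divfK d0) -ab subrr mul0r.
have : (p%:Z %| numq (x - y) * d)%Z by rewrite (cross _ m d) // dvdz_mulr.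
by rewrite !pF intrM mulf_eq0 (negPf d0) orbF.
Qed.

(** -1/3 reduces to [n], so the defining products correspond factor by factor; [k < p] keeps [k!]
    invertible. *)
Lemma rbinom_reduces_to (p n k : nat) : prime p -> (3 < p)%N ->
  (3 * n + 1)%:R = 0 :> 'F_p -> (k < p)%N ->
  reduces_to (rbinom (- (1 / 3)) k) ('C(n, k)%:R : 'F_p).
Proof.
move=> p_prime p_gt3 n_eq k_lt.
have three0 : 3%:R != 0 :> 'F_p by apply: Fp_natr_neq0.
have fk := Fp_fact_neq0 p_prime k_lt.
have ffactE : (n ^_ k)%:R = \prod_(i < k) (n%:R - i%:R) :> 'F_p.
  elim: (k) => [|j IHj]; first by rewrite big_ord0.
  rewrite big_ord_recr /= -IHj ffactnSr natrM; have [jn|nj] := leqP j n.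
    by rewrite natrB.
  by rewrite ffact_small // !mul0r.
have third : reduces_to (- (1 / 3)) (n%:R : 'F_p).
  have -> : n%:R = - (1 / 3%:R) :> 'F_p.
    apply: (mulfI three0); rewrite mul1r mulrN mulfV //.
    by apply/eqP; rewrite -subr_eq0 opprK -natrM natr1 -addn1 n_eq.
  apply/reduces_toN/reduces_toM; first exact: (reduces_to_nat p 1).
  exact/(reduces_toV three0)/reduces_to_nat.
have -> : 'C(n, k)%:R = (\prod_(i < k) (n%:R - i%:R)) / k`!%:R :> 'F_p.
  by apply: (mulIf fk); rewrite divfK // -ffactE -natrM bin_ffact.
apply: reduces_toM; last exact/(reduces_toV fk)/reduces_to_nat.
apply: (@reduces_to_prod p k (fun i => - (1 / 3) - i%:R) (fun i => n%:R - i%:R)) => i.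
by apply: reduces_toD => //; exact/reduces_toN/reduces_to_nat.
Qed.

Lemma sum_rbinom_sqr_reduces_to (p n : nat) (x : rat) (a : 'F_p) : prime p -> (3 < p)%N ->
  (n < p)%N -> (3 * n + 1)%:R = 0 :> 'F_p -> reduces_to x a ->
  reduces_to (\sum_(0 <= k < p) rbinom (- (1 / 3)) k ^+ 2 * x ^+ k)
    (\sum_(k < n.+1) 'C(n, k)%:R ^+ 2 * a ^+ k).
Proof.
move=> p_prime p_gt3 n_lt n_eq xa.
rewrite -(@big_nat_vanish _ n.+1 p (fun k => 'C(n, k)%:R ^+ 2 * a ^+ k)) //; last first.
  by move=> k nk; rewrite bin_small // expr0n mul0r.
apply: reduces_to_sum => k; rewrite mem_index_iota => /andP[_ k_lt].
apply: reduces_toM; apply: reduces_toX => //.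
exact: rbinom_reduces_to.
Qed.

(** * The sum at 9 in each residue class mod 3, and the congruences *)

(** The squared binomials are symmetric under [k -> n - k], so the polynomial is self-reciprocal. *)
Lemma sum_sqr_bin_expV (K : fieldType) (n : nat) (a : K) : a != 0 ->
  \sum_(k < n.+1) 'C(n, k)%:R ^+ 2 * a^-1 ^+ k =
  a^-1 ^+ n * \sum_(k < n.+1) 'C(n, k)%:R ^+ 2 * a ^+ k.
Proof.
move=> a0; rewrite mulr_sumr (reindex_inj rev_ord_inj) /=; apply: eq_bigr => k _.
have kn := leq_ord k; rewrite subSS bin_sub // mulrCA; congr (_ * _).
have -> : a^-1 ^+ n = a^-1 ^+ (n - k) * a^-1 ^+ k by rewrite -exprD subnK.
by rewrite -mulrA -exprMn mulVf // expr1n mulr1.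
Qed.

(** For the Fermat cubic only the term [j = n] of [cubic_form_sumE] survives. There C(p-1,2n) = 1,
    and the factor 8^n = 2^(p-1) is 1. *)
Lemma sum_sqr_bin_Fp1 (p n : nat) : prime p -> (3 < p)%N -> p = (3 * n + 1)%N ->
  \sum_(k < n.+1) 'C(n, k)%:R ^+ 2 * 9%:R ^+ k = 'C(2 * n, n)%:R :> 'F_p.
Proof.
move=> p_prime p_gt3 p_eq.
have n_eq : (3 * n + 1)%:R = 0 :> 'F_p by rewrite -p_eq pchar_Fp_0.
have p_pred : p.-1 = (3 * n)%N by rewrite p_eq addn1.
have card_F : #|'F_p|.-1 = (3 * n)%N by rewrite card_Fp.
have three0 : 3%:R != 0 :> 'F_p by apply: Fp_natr_neq0.
have two0 : 2%:R != 0 :> 'F_p by apply: Fp_natr_neq0 => //; lia.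
have [g [_ _ w_root]] := exists_cubic_root card_F.
rewrite sum_sqr_bin_cubic_form //; last by lia.
rewrite (cubic_form_sum6_root three0 w_root) cubic_form_sumE card_F.
have lt_n : (n < (3 * n).+1)%N by lia.
rewrite big_mkord (bigD1 (Ordinal lt_n)) //= subnn binn mul1n mulr1 big1 ?addr0.
  rewrite mulrN opprK natrM -[in 'C(3 * n, _)]p_pred bin_pred_prime //; last by lia.
  rewrite exprM sqrrN !expr1n mul1r (natrX _ 2 3) -exprM -p_pred Fp_expf_pred //.
  by rewrite mul1r.
move=> j /eqP/val_eqP /= jn; have [j_lt|j_ge] := ltnP j n.
  by rewrite expr0n (_ : (3 * n - 3 * j == 0)%N = false) ?mulr0 //; lia.
by rewrite (bin_small (n := 3 * n)) ?mul0n ?mul0r //; lia.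
Qed.

(** Since 3n = 2(p - 1) + 1, the [n]-th power inverts cubing. *)
Lemma sum_sqr_bin_Fp2 (p n : nat) : prime p -> (3 < p)%N -> (2 * p)%N = (3 * n + 1)%N ->
  \sum_(k < n.+1) 'C(n, k)%:R ^+ 2 * 9%:R ^+ k = 0 :> 'F_p.
Proof.
move=> p_prime p_gt3 p_eq.
have n_eq : (3 * n + 1)%:R = 0 :> 'F_p by rewrite -p_eq natrM pchar_Fp_0 // mulr0.
have three0 : 3%:R != 0 :> 'F_p by apply: Fp_natr_neq0.
have cube_inj : injective (fun x : 'F_p => x ^+ 3).
  have cubeK (x : 'F_p) : x = (x ^+ 3) ^+ n.
    have [->|x0] := eqVneq x 0; first by rewrite expr0n /= expr0n; case: (n) p_eq p_gt3 => //; lia.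
    rewrite -exprM (_ : 3 * n = p.-1 * 2 + 1)%N; last by lia.
    by rewrite exprD exprM Fp_expf_pred // expr1n mul1r.
  by move=> x y /= xy; rewrite (cubeK x) xy -cubeK.
rewrite sum_sqr_bin_cubic_form //; last by lia.
by rewrite cubic_form_sum6_inj // mulr0 oppr0.
Qed.

Theorem theorem6p1 (p : nat) (p_prime : prime p) (p_gt3 : (3 < p)%N) :
  let S1 : rat := \sum_(0 <= k < p) rbinom (- (1 / 3)) k ^+ 2 * 9 ^+ k in
  let S2 : rat := 1 / 3 ^+ (p %/ 3)
    * \sum_(0 <= k < p) rbinom (- (1 / 3)) k ^+ 2 * (1 / 9 ^+ k) in
  [/\ rat_congr p S1 S2,
      p = 1 %[mod 3] ->
        forall L M : int,
          (4 * p)%:Z = L ^+ 2 + 27 * M ^+ 2 -> (3 %| L - 2)%Z ->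
          rat_congr p S2 L%:~R
    & p = 2 %[mod 3] -> rat_congr p S2 0].
Proof.
move=> S1 S2.
have three0 : 3%:R != 0 :> 'F_p by apply: Fp_natr_neq0.
have nine0 : 9%:R != 0 :> 'F_p by rewrite (natrX _ 3 2) expf_neq0.
have red n : (n < p)%N -> (3 * n + 1)%:R = 0 :> 'F_p ->
    let s := \sum_(k < n.+1) 'C(n, k)%:R ^+ 2 * 9%:R ^+ k : 'F_p in
    reduces_to S1 s /\ reduces_to S2 (3%:R^-1 ^+ (p %/ 3) * (9%:R^-1 ^+ n * s)).
  move=> n_lt n_eq s; split.
    apply: sum_rbinom_sqr_reduces_to => //; exact: (reduces_to_nat p 9).
  rewrite /S2 mul1r -exprVn; apply: reduces_toM.
    exact/reduces_toX/(reduces_toV three0)/reduces_to_nat.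
  rewrite -sum_sqr_bin_expV //.
  under eq_bigr do rewrite -exprVn [1 * _ ^+ _]mul1r.
  apply: sum_rbinom_sqr_reduces_to => //.
  exact/(reduces_toV nine0)/reduces_to_nat.
have p_mod3 : (p %% 3 == 1)%N || (p %% 3 == 2)%N.
  have : ~~ (3 %| p)%N by rewrite dvdn_prime2 //; lia.
  by lia.
have [p1|p1] := boolP (p %% 3 == 1)%N.
  have p_eq : p = (3 * (p %/ 3) + 1)%N by lia.
  have n_eq : (3 * (p %/ 3) + 1)%:R = 0 :> 'F_p by rewrite -p_eq pchar_Fp_0.
  have [] := red (p %/ 3)%N _ n_eq; first by lia.
  rewrite mulrA -exprMn -invfM -natrM sum_sqr_bin_Fp1 //.
  (* Here [n = p %/ 3], so the two prefactors combine to 27^(-n) = 3^(-(p-1)) = 1. *)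
  have -> : (3 * 9)%:R^-1 ^+ (p %/ 3) = 1 :> 'F_p.
    rewrite (natrX _ 3 3) exprVn -exprM [(3 * _)%N](_ : _ = p.-1); last by lia.
    by rewrite Fp_expf_pred // invr1.
  rewrite mul1r => S1red S2red; split; first exact: reduces_to_congr S1red S2red.
    move=> _ L M LM L3; apply: (reduces_to_congr p_prime S2red).
    (* Gauss's representation has first coordinate C(2n,n) mod [p]; by uniqueness it is the given
       [L]. *)
    have [|A [B [AB A3 <-]]] := @gauss_cubic 'F_p (p %/ 3).
      by rewrite card_Fp //; lia.
    rewrite card_Fp // in AB.
    by rewrite (quad_form_unique p_prime AB LM A3 L3); exact: reduces_to_int.
  by rewrite (eqP p1).
(* For p = 2 mod 3 it is [2 * p], not [p], that has the form 3n + 1. *)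
pose n := ((2 * p).-1 %/ 3)%N.
have p_eq : (2 * p)%N = (3 * n + 1)%N by rewrite /n; lia.
have n_eq : (3 * n + 1)%:R = 0 :> 'F_p by rewrite -p_eq natrM pchar_Fp_0 // mulr0.
have [] := red n _ n_eq; first by lia.
rewrite sum_sqr_bin_Fp2 // !mulr0 => S1red S2red.
split; first exact: reduces_to_congr S1red S2red.
  by move=> p1'; rewrite p1' in p1.
by move=> _; exact: (reduces_to_congr p_prime S2red (reduces_to_nat p 0)).
Qed.
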